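(* Let $a,b\in I$ with $a<b$ and $a\le s_0\le b$. Let $f:[a,b]\to\mathbb{R}$ be absolutely $\beta$-integrable on $[a,b]$. If $u:[a,b]\to\mathbb{R}$ is $\beta$-$L$-Lipschitzian on $[a,b]$, then $$\left|\int_a^b f(x)\,d_\beta u(x)\right|\le L\int_a^b|f(x)|\,d_\beta x .$$
   Context: Setting: $I\subseteq\mathbb{R}$ is an interval and $\beta:I\to I$ is a strictly increasing continuous function with exactly one fixed point $s_0\in I$, satisfying $(t-s_0)(\beta(t)-t)\le 0$ for all $t\in I$, with equality only if $t=s_0$. Write $\beta^0(t)=t$ and $\beta^k$ for the $k$-fold composition of $\beta$ with itself. For $a,b\in I$, $[a,b]_\beta:=\{\beta^k(a):k\ge 0\}\cup\{\beta^k(b):k\ge 0\}\cup\{s_0\}$. The $\beta$-integral is $\int_a^b h\,d_\beta:=\int_{s_0}^b h\,d_\beta-\int_{s_0}^a h\,d_\beta$, where $\int_{s_0}^x h\,d_\beta:=\sum_{k=0}^{\infty}\big(\beta^k(x)-\beta^{k+1}(x)\big)h\big(\beta^k(x)\big)$; also written $\int_a^b h(x)\,d_\beta x$. The function $h$ is $\beta$-integrable on $[a,b]$ if these series converge for $x=a$ and $x=b$, and absolutely $\beta$-integrable on $[a,b]$ if $|h|$ is $\beta$-integrable on $[a,b]$. Riemann–Stieltjes $\beta$-integral: for a real function $u$ of bounded variation on $[a,b]_\beta$, $$\int_a^b f(x)\,d_\beta u(x):=\sum_{k=0}^\infty f(\beta^k(b))\big(u(\beta^k(b))-u(\beta^{k+1}(b))\big)-\sum_{k=0}^\infty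 f(\beta^k(a))\big(u(\beta^k(a))-u(\beta^{k+1}(a))\big).$$ A real function $u$ is $\beta$-$L$-Lipschitzian on $[a,b]$ if $|u(x)-u(\beta(x))|\le L|x-\beta(x)|$ for all $x\in[a,b]_\beta$. (Such a function is automatically of bounded variation on $[a,b]_\beta$.) *)

(* Defs.v *)
From HB Require Import structures.
From mathcomp Require Import all_boot all_order all_algebra.
From mathcomp Require Import all_classical all_reals all_analysis.
Import Order.TTheory GRing.Theory Num.Theory numFieldNormedType.Exports.

Set Implicit Arguments.
Unset Strict Implicit.
Unset Printing Implicit Defensive.

Local Open Scope classical_set_scope.
Local Open Scope ring_scope.

(* Functions defined on a subset of the line are represented by total functions
   R -> R of which only the values on that subset matter; the k-fold composition
   of beta with itself at x is iter k beta x. *)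

Definition beta_system (R : realType) (I : set R) (beta : R -> R) (s0 : R)
    : Prop :=
  [/\ is_interval I,
      forall t, I t -> I (beta t),
      forall x y, I x -> I y -> x < y -> beta x < beta y &
      {within I, continuous beta}] /\
  [/\ I s0 /\ beta s0 = s0,
      forall t, I t -> beta t = t -> t = s0,
      forall t, I t -> (t - s0) * (beta t - t) <= 0 &
      forall t, I t -> (t - s0) * (beta t - t) = 0 -> t = s0].

Definition beta_interval (R : realType) (beta : R -> R) (s0 a b : R) : set R :=
  range (fun k : nat => iter k beta a) `|` range (fun k : nat => iter k beta b)
  `|` [set s0].

Definition beta_term (R : realType) (beta h : R -> R) (x : R) : R ^nat :=
  fun k => (iter k beta x - iter k.+1 beta x) * h (iter k beta x).

(* limn is an unspecified value when the series diverges; convergence is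
   expressed separately by beta_integrable. *)
Definition beta_integral (R : realType) (beta h : R -> R) (a b : R) : R :=
  limn (series (beta_term beta h b)) - limn (series (beta_term beta h a)).

Definition beta_integrable (R : realType) (beta h : R -> R) (a b : R) : Prop :=
  cvgn (series (beta_term beta h a)) /\ cvgn (series (beta_term beta h b)).

Definition abs_beta_integrable (R : realType) (beta h : R -> R) (a b : R)
    : Prop :=
  beta_integrable beta (fun x => `|h x|) a b.

Definition beta_RS_term (R : realType) (beta f u : R -> R) (x : R) : R ^nat :=
  fun k => f (iter k beta x) * (u (iter k beta x) - u (iter k.+1 beta x)).

Definition beta_RS_integral (R : realType) (beta f u : R -> R) (a b : R) : R :=
  limn (series (beta_RS_term beta f u b))
  - limn (series (beta_RS_term beta f u a)).

Definition beta_RS_integrable (R : realType) (beta f u : R -> R) (a b : R)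
    : Prop :=
  cvgn (series (beta_RS_term beta f u a)) /\
  cvgn (series (beta_RS_term beta f u b)).

Definition beta_lipschitzian (R : realType) (beta : R -> R) (s0 L : R)
    (u : R -> R) (a b : R) : Prop :=
  forall x, beta_interval beta s0 a b x ->
    `|u x - u (beta x)| <= L * `|x - beta x|.

(* Main.v *)
(** Along the orbit of [b], which stays to the right of [s0], the steps
    [x - beta x] are nonnegative; along the orbit of [a] they are nonpositive.
    Hence the Lipschitz condition dominates the Riemann-Stieltjes terms by
    [L] times the beta-integral terms of [|f|] at [b], and by [-L] times those
    at [a], so the two series converge absolutely and the bounds add up. *)
Require Import Defs.
From HB Require Import structures.
From mathcomp Require Import all_boot all_order all_algebra.
From mathcomp Require Import all_classical all_reals all_analysis.
Import Order.TTheory GRing.Theory Num.Theory numFieldNormedType.Exports.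
Local Open Scope classical_set_scope.
Local Open Scope ring_scope.

Set Implicit Arguments.
Unset Strict Implicit.

(** Comparison test, with the factor [c] then pulled out of the limit. The sign of [c] is left free
    so that a negative constant can be paired with nonpositive terms [w k]. *)
Lemma series_dominated (R : realType) (c : R) (v w : R ^nat) :
  (forall k, `|v k| <= c * w k) -> cvgn (series w) ->
  cvgn (series v) /\ `|limn (series v)| <= c * limn (series w).
Proof.
move=> vw cw.
have cwE : series (c *: w) = c *: series w.
  by apply/funext => n; rewrite /series /= -scaler_sumr.
have ccw : cvgn (series (c *: w)) by rewrite cwE; exact: is_cvgZl_tmp.
have cnv : cvgn [normed series v].
  apply: series_le_cvg ccw => [k|k|k]; [exact: normr_ge0| |exact: vw].
  (* Each [c * w k] is nonnegative because it bounds an absolute value. *)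
  exact: (le_trans (normr_ge0 _) (vw k)).
split; first exact: normed_cvg.
apply: (le_trans (lim_series_norm cnv)).
have -> : c * limn (series w) = limn (series (c *: w)).
  by rewrite cwE limZl_tmp.
exact: lim_series_le.
Qed.

Lemma beta_homo_le (R : realType) (I : set R) (beta : R -> R) (s0 : R) x y :
  beta_system I beta s0 -> I x -> I y -> x <= y -> beta x <= beta y.
Proof.
case=> -[_ _ incr _] _ Ix Iy; rewrite le_eqVlt => /predU1P[->//|xy].
exact/ltW/incr.
Qed.

(** Monotonicity and [beta s0 = s0] prevent an orbit from crossing [s0]. *)
Lemma iter_beta_ge (R : realType) (I : set R) (beta : R -> R) (s0 : R) k x :
  beta_system I beta s0 -> I x -> s0 <= x ->
  I (iter k beta x) /\ s0 <= iter k beta x.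
Proof.
move=> hbeta Ix sx; elim: k => [//|k [Ik sk]] /=.
case: (hbeta) => -[_ stab _ _] [[Is0 fix0] _ _ _].
by split; [exact: stab|rewrite -fix0; exact: (beta_homo_le hbeta)].
Qed.

Lemma iter_beta_le (R : realType) (I : set R) (beta : R -> R) (s0 : R) k x :
  beta_system I beta s0 -> I x -> x <= s0 ->
  I (iter k beta x) /\ iter k beta x <= s0.
Proof.
move=> hbeta Ix xs; elim: k => [//|k [Ik ks]] /=.
case: (hbeta) => -[_ stab _ _] [[Is0 fix0] _ _ _].
by split; [exact: stab|rewrite -fix0; exact: (beta_homo_le hbeta)].
Qed.

(** For [s0 < x], the positive factor [x - s0] cancels from the sign condition on [beta]; at [s0]
    the fixed point gives equality. *)
Lemma beta_le_id (R : realType) (I : set R) (beta : R -> R) (s0 : R) x :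
  beta_system I beta s0 -> I x -> s0 <= x -> beta x <= x.
Proof.
case=> _ [[_ fix0] _ attr _] Ix.
rewrite le_eqVlt => /predU1P[<-|sx]; first by rewrite fix0.
by have := attr _ Ix; rewrite pmulr_rle0 ?subr_gt0// subr_le0.
Qed.

Lemma beta_ge_id (R : realType) (I : set R) (beta : R -> R) (s0 : R) x :
  beta_system I beta s0 -> I x -> x <= s0 -> x <= beta x.
Proof.
case=> _ [[_ fix0] _ attr _] Ix.
rewrite le_eqVlt => /predU1P[->|xs]; first by rewrite fix0.
by have := attr _ Ix; rewrite nmulr_rle0 ?subr_lt0// subr_ge0.
Qed.

Theorem proposition4p4 (R : realType) (I : set R) (beta : R -> R) (s0 : R)
  (hbeta : beta_system I beta s0)
  (a b : R) (ha : I a) (hb : I b) (hab : a < b) (has0 : a <= s0) (hs0b : s0 <= b)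
  (f : R -> R) (hf : abs_beta_integrable beta f a b)
  (L : R) (u : R -> R) (hu : beta_lipschitzian beta s0 L u a b) :
  beta_RS_integrable beta f u a b /\
  `|beta_RS_integral beta f u a b|
    <= L * beta_integral beta (fun x => `|f x|) a b.
Proof.
case: hf => cfa cfb.
have [k|cb leb] := @series_dominated R L (beta_RS_term beta f u b) _ _ cfb.
  have [Ik sk] := iter_beta_ge k hbeta hb hs0b.
  (* Cancelling the common factor [|f|] leaves the Lipschitz bound at the [k]-th iterate. *)
  rewrite /beta_RS_term /beta_term normrM mulrA mulrC ler_wpM2r//=.
  have := hu (iter k beta b); rewrite (@ger0_norm _ (_ - beta _)).
    by apply; left; right; exists k.
  by rewrite subr_ge0; exact: (beta_le_id hbeta).
have [k|ca lea] := @series_dominated R (- L) (beta_RS_term beta f u a) _ _ cfa.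
  have [Ik sk] := iter_beta_le k hbeta ha has0.
  rewrite /beta_RS_term /beta_term normrM mulrA mulrC ler_wpM2r//= mulNr -mulrN.
  have := hu (iter k beta a); rewrite (@ler0_norm _ (_ - beta _)).
    by apply; left; left; exists k.
  by rewrite subr_le0; exact: (beta_ge_id hbeta).
(* The limit at [a] enters [beta_integral] with a minus sign, so the right-hand side is exactly the
   sum of the bounds [leb] and [lea]. *)
split=> //; rewrite /beta_RS_integral /beta_integral mulrBr -mulNr.
by rewrite (le_trans (ler_normB _ _))// lerD.
Qed.
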